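(* Suppose that $\liminf_{i\to\infty} q_i>0$. For each $k\ge 1$ let $\boldsymbol{\alpha}^{(k)}=(\alpha^{(k)}_1,\dots,\alpha^{(k)}_k)$ be a probability distribution on $\{1,\dots,k\}$, and suppose that there exist constants $N_1,N_2\ge 1$ and $a>0$, all independent of $k$, such that $$\sum_{j=1}^{\min\{N_1,k\}}\alpha^{(k)}_j\ge a\qquad\text{for all }k\ge N_2 .$$ Let $i\ge 1$ be an initial type, and suppose that $N_1$ above is such that either (i) $\tilde q_j<1$ for all $j\in\{1,\dots,N_1\}$, or (ii) $\tilde q_j=1$ for all $j\in\{1,\dots,N_1\}$, and there is a path from any $j\in\{1,\dots,N_1\}$ to the initial type $i$. Then $\lim_{k\to\infty}\bar q^{(k)}_i=q_i$. In particular, if $\{\boldsymbol{Z}_n\}$ is irreducible, if $\liminf_{i\to\infty}q_i>0$, and if there exist constants $N_1,N_2\ge1$ and $a>0$ independent of $k$ with $\sum_{j=1}^{\min\{N_1,k\}}\alpha^{(k)}_j\ge a$ for all $k\ge N_2$, then $\lim_{k\to\infty}\bar{\boldsymbol q}^{(k)}=\boldsymbol q$ (entrywise).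
   Context: $\{\boldsymbol Z_n\}_{n\ge0}$ is a multitype Galton–Watson branching process with countably infinite type set $\mathcal S=\{1,2,3,\dots\}$, started from a single individual whose type is denoted $\varphi_0$. Each individual lives one generation and, at death, independently of all other individuals, an individual of type $i$ produces $\boldsymbol r=(r_1,r_2,\dots)$ offspring ($r_j$ of type $j$, finitely many $r_j$ nonzero) with probability $p_i(\boldsymbol r)$. $Z_{n,j}$ is the number of type-$j$ individuals in generation $n$ and $|\boldsymbol Z_n|=\sum_j Z_{n,j}$. Write $\mathbf P_i(\cdot)=\mathbf P(\cdot\mid\varphi_0=i)$. The mean progeny matrix is $M=(M_{ij})_{i,j\in\mathcal S}$, where $M_{ij}$ is the expected number of type-$j$ children of a type-$i$ parent; its row sums are assumed finite. There is a path from type $i$ to type $j$ if there is a directed path from $i$ to $j$ in the graph on $\mathcal S$ that has an edge $u\to v$ if and only if $M_{uv}>0$; the process is irreducible if there is a path between every pair of types. The global extinction probabilities are $q_i=\mathbf P_i(\lim_{n}|\boldsymbol Z_n|=0)$ and the partial extinction probabilities are $\tilde q_i=\mathbf P_i(\forall l\ge1:\lim_n Z_{n,l}=0)$; $\boldsymbol q=(q_i)_{i\ge 1}$, $\tilde{\boldsymbol q}=(\tilde q_i)_{i\ge 1}$. Given $k\ge1$ and a replacement distribution $\boldsymbol\alpha^{(k)}$ on $\{1,\dots,k\}$, $\{\bar{\boldsymbol Z}^{(k)}_n\}$ is the branching process in which types in $\{1,\dots,k\}$ have the same progeny distribution as in $\{\boldsymbol Z_n\}$, except that every individual of type larger than $k$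 is instantaneously, and independently of everything else, replaced by an individual whose type is drawn from $\boldsymbol\alpha^{(k)}$ (and which then reproduces according to its new type). Its extinction probability vector is $\bar{\boldsymbol q}^{(k)}=(\bar q^{(k)}_i)_{i\ge1}$, $\bar q_i^{(k)}=\mathbf P_i(\lim_n|\bar{\boldsymbol Z}^{(k)}_n|=0)$; for $i>k$, $\bar q^{(k)}_i=\sum_{j=1}^k\alpha^{(k)}_j\bar q^{(k)}_j$. *)

(* Defs.v *)
From HB Require Import structures.
From mathcomp Require Import all_boot all_order all_algebra.
From mathcomp Require Import finmap multiset.
From mathcomp Require Import all_classical all_reals all_analysis.

Set Implicit Arguments.
Unset Strict Implicit.
Unset Printing Implicit Defensive.

Import Order.TTheory GRing.Theory Num.Theory.
Import numFieldNormedType.Exports.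

Local Open Scope classical_set_scope.
Local Open Scope ring_scope.
Local Open Scope ereal_scope.

(* Types are numbered from 0: the natural number i stands for the type i + 1 of
   S = {1, 2, ...}, so that {1, ..., k} is the set of the i with i < k.
   A population is a finitely supported vector (r_j)_(j in S) of counts. *)
Definition pop : choiceType := {mset nat}%mset.

Section Law.
Variable R : realType.

(* A law on populations is given by its (extended-real) mass function; [is_law]
   makes all the values lie in [0, 1]. *)
Definition law := pop -> \bar R.

Definition is_law (mu : law) : Prop :=
  (forall r, 0 <= mu r) /\ \esum_(r in [set: pop]) mu r = 1.

Definition dirac_law (r : pop) : law := fun s => ((r == s)%:R)%:E.

(* Law of the sum of two independent populations. *)
Definition conv_law (mu nu : law) : law := fun s =>
  \esum_(x in [set x : pop * pop | (x.1 `+` x.2)%mset = s]) (mu x.1 * nu x.2).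

(* Law of the population obtained from z when every individual, independently
   of the others, is substituted by a random population, whose law is [f i] for
   an individual of type i.  The fold runs over the list of all individuals
   of z, in which each type occurs with its multiplicity. *)
Definition branch (f : nat -> law) (z : pop) : law :=
  foldr (fun i mu => conv_law (f i) mu) (dirac_law mset0) (enum_mset z).

(* Law of the population which a single individual of type j becomes when types
   outside {0, ..., k - 1} are replaced according to alpha. *)
Definition replace1 (k : nat) (alpha : 'I_k -> R) (j : nat) : law := fun s =>
  if (j < k)%N then dirac_law [mset j]%mset s
  else \sum_(l < k) (alpha l)%:E * dirac_law [mset val l]%mset s.

Definition replace_law (k : nat) (alpha : 'I_k -> R) (mu : law) : law :=
  fun s =>
  \esum_(r in [set: pop]) (mu r * branch (replace1 alpha) r s).

Definition is_distribution (k : nat) (alpha : 'I_k -> R) : Prop :=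
  (forall j, (0 <= alpha j)%R) /\ (\sum_(j < k) alpha j)%R = 1%R.

Definition mean (p : nat -> law) (i j : nat) : \bar R :=
  \esum_(r in [set: pop]) (p i r * (r j)%:R%:E).

(* The path of length 0 from a type to itself is allowed. *)
Definition has_path (p : nat -> law) (i j : nat) : Prop :=
  exists s : seq nat, path (fun u v => 0 < mean p u v) i s /\ last i s = j.

Definition irreducible (p : nat -> law) : Prop := forall i j, has_path p i j.

End Law.

Section Process.
Variables (R : realType) (d : measure_display) (Omega : measurableType d).

(* Under P, the generation sizes Z form a branching process with progeny laws p
   whose generation 0 has law init: conditionally on generations 0, ..., n, the
   generation n + 1 is the sum of independent litters, one for each individual
   of generation n, of law p i when that individual has type i. *)
Definition branching_process (P : probability Omega R) (init : law R)
    (p : nat -> law R) (Z : nat -> Omega -> pop) : Prop :=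
  [/\ forall n z, measurable [set w | Z n w = z],
      forall z, P [set w | Z 0%N w = z] = init z &
      forall (n : nat) (h : nat -> pop),
        P [set w | forall m, (m <= n.+1)%N -> Z m w = h m] =
        P [set w | forall m, (m <= n)%N -> Z m w = h m]
          * branch p (h n) (h n.+1)].

(* [P i] is the probability measure for the initial type i. *)
Definition galton_watson (p : nat -> law R) (P : nat -> probability Omega R)
    (Z : nat -> Omega -> pop) : Prop :=
  forall i, branching_process (P i) (dirac_law R [mset i]%mset) p Z.

(* The initial individual and all the children are subject to replacement, so
   that the types k, k + 1, ... almost surely never reproduce here: the progeny
   laws of index at least k are irrelevant. *)
Definition replaced_galton_watson (p : nat -> law R) (k : nat)
    (alpha : 'I_k -> R) (P : nat -> probability Omega R)
    (Z : nat -> Omega -> pop) : Prop :=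
  forall i, branching_process (P i) (replace1 alpha i)
              (fun j => replace_law alpha (p j)) Z.

(* [size] counts all the individuals, i.e. it is the l1 norm of the vector. *)
Definition extinction (Z : nat -> Omega -> pop) : set Omega :=
  [set w | size (enum_mset (Z n w)) @[n --> \oo] --> 0%N].

Definition partial_extinction (Z : nat -> Omega -> pop) : set Omega :=
  [set w | forall l : nat, Z n w l @[n --> \oo] --> 0%N].

End Process.

(* Main.v *)
(* Generating functions reduce everything to the iteration of
   G(s)_j = E_j[s ^ Z_1] : q is the limit of the iterates of G at 0.  Freeze
   the types from k on, and let F_k(s)_i be the expectation under P_i of
   s ^ S_k on the event that eventually only frozen individuals are left, S_k
   being their number.

   - F_k(0)_i -> q_i, since G is lower semicontinuous.
   - If eps <= q_l for all l >= k then F_k(eps) <= q, since q is a fixed point.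
   - F_k(s) - F_k(0) <= s ^ m + eps ^ -m * (F_k(eps) - F_k(0)) for every m, and
     hence F_k(s)_i -> q_i for every fixed s < 1.

   If q_j < 1 for all j <= N1, fix s < 1 with s > 1 - a + a * max_(j <= N1) q_j.
   Then sum_j alpha_j F_k(s)_j <= s for k large, so that F_k(s) is a
   supersolution of the equations whose minimal solution is bar q^(k), and
   F_k(0)_i <= bar q^(k)_i <= F_k(s)_i.  Extinction implies partial extinction
   and q_j = 1 propagates along paths, so each of the hypotheses gives either
   q_i = 1, when only the lower bound is needed, or q_j < 1 for all j <= N1. *)
Require Import Defs.
From HB Require Import structures.
From mathcomp Require Import all_boot all_order all_algebra.
From mathcomp Require Import finmap multiset.
From mathcomp Require Import all_classical all_reals all_analysis.
From mathcomp Require Import lra.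

Set Implicit Arguments.
Unset Strict Implicit.
Unset Printing Implicit Defensive.

Import Order.TTheory GRing.Theory Num.Theory.
Import numFieldNormedType.Exports.

Local Open Scope classical_set_scope.
Local Open Scope ring_scope.
Local Open Scope ereal_scope.

(** * Sums of nonnegative extended reals *)

Section Esum.
Variable R : realType.

Lemma ge0_esumZl (T : choiceType) (S : set T) (c : R) (a : T -> \bar R) :
  (0 <= c)%R -> (forall i, 0 <= a i) ->
  \esum_(i in S) (c%:E * a i) = c%:E * \esum_(i in S) a i.
Proof.
move=> c0 a0; rewrite /esum -ereal_supZl//; last first.
  by apply/set0P; exists (\sum_(x \in set0) a x); exists set0 => //; exact: fsets_set0.
congr ereal_sup; apply/seteqP; split => x /=.
  move=> [A SA <-]; exists (\sum_(x \in A) a x); first by exists A.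
  by rewrite ge0_mule_fsumr.
by move=> [_ [A SA <-] <-]; exists A => //; rewrite ge0_mule_fsumr.
Qed.

Lemma exchange_esum (T U : choiceType) (a : T -> U -> \bar R) :
  (forall i j, 0 <= a i j) ->
  \esum_(i in [set: T]) \esum_(j in [set: U]) a i j =
  \esum_(j in [set: U]) \esum_(i in [set: T]) a i j.
Proof.
move=> a0; rewrite !esum_esum//.
rewrite [LHS](@reindex_esum _ _ _ ([set: U] `*`` (fun=> [set: T])) _
  (fun x => (x.2, x.1)))//.
split => //= [[? ?] [? ?] _ _ [-> ->]//|[x y] _ /=].
by exists (y, x).
Qed.

Lemma esum_ge1 (T : choiceType) (S : set T) (a : T -> \bar R) t :
  S t -> a t <= \esum_(i in S) a i.
Proof.
move=> St; apply: esum_ge; exists [set t]; last by rewrite fsbig_set1.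
by split; [exact: finite_set1|move=> _ ->].
Qed.

End Esum.

(** * Generating functions of laws on populations *)

Section GeneratingFunction.
Variable R : realType.
Implicit Types (mu nu : law R) (s t : nat -> R) (z : pop) (f : nat -> law R).

(** The monomial s ^ z, with one factor per individual, so that inductions run over the same list as
    the fold in [branch]. *)
Definition mon s z : R := (\prod_(i <- enum_mset z) s i)%R.

Definition gf mu s : \bar R := \esum_(r in [set: pop]) (mu r * (mon s r)%:E).

Definition in_cube s := forall i, (0 <= s i <= 1)%R.

Lemma mon0 s : mon s mset0 = 1%R.
Proof. by rewrite /mon enum_mset0 big_nil. Qed.

Lemma mon1 s i : mon s [mset i]%mset = s i.
Proof. by rewrite /mon enum_msetn big_seq1. Qed.

Lemma monD s y z : mon s (y `+` z)%mset = (mon s y * mon s z)%R.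
Proof.
rewrite /mon -big_cat/=; apply: perm_big; apply/allP => x _ /=.
by rewrite count_cat !count_mem_mset msetE2.
Qed.

Lemma mon_ge0 s z : in_cube s -> (0 <= mon s z)%R.
Proof. by move=> s01; apply: prodr_ge0 => i _; case/andP: (s01 i). Qed.

Lemma le_mon s t z : (forall i, 0 <= s i <= t i)%R -> (mon s z <= mon t z)%R.
Proof. by move=> st; apply: ler_prod => i _. Qed.

Lemma mon_cst (c : R) z : mon (fun=> c) z = (c ^+ size (enum_mset z))%R.
Proof. by rewrite /mon big_const_seq iter_mulr_1 count_predT. Qed.

Lemma mon_le1 s z : in_cube s -> (mon s z <= 1)%R.
Proof.
move=> s01; rewrite -(expr1n R (size (enum_mset z))) -mon_cst.
by apply: le_mon.
Qed.

Lemma law_ge0 mu z : is_law mu -> 0 <= mu z.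
Proof. by case. Qed.

Lemma law_le1 mu z : is_law mu -> mu z <= 1.
Proof. by move=> [_ <-]; exact: esum_ge1. Qed.

Lemma law_fin mu z : is_law mu -> mu z = (fine (mu z))%:E.
Proof.
move=> mul; rewrite fineK// ge0_fin_numE ?law_ge0//.
by rewrite (le_lt_trans (law_le1 z mul)) ?ltry.
Qed.

Lemma fine_law_ge0 mu z : is_law mu -> (0 <= fine (mu z))%R.
Proof. by move=> mul; rewrite fine_ge0// law_ge0. Qed.

Lemma gf_term_ge0 mu s z : is_law mu -> in_cube s -> 0 <= mu z * (mon s z)%:E.
Proof. by move=> mul s01; rewrite mule_ge0 ?law_ge0 ?lee_fin ?mon_ge0. Qed.

Lemma gf_ge0 mu s : is_law mu -> in_cube s -> 0 <= gf mu s.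
Proof. by move=> mul s01; apply: esum_ge0 => z _; exact: gf_term_ge0. Qed.

Lemma le_gf mu s t : is_law mu -> (forall i, 0 <= s i <= t i)%R ->
  gf mu s <= gf mu t.
Proof.
move=> mul st; apply: le_esum => z _.
by rewrite lee_wpmul2l ?law_ge0 ?lee_fin ?le_mon.
Qed.

(** Used to prove that a construction is a law: its generating function is explicit, in particular
    at 1. *)
Lemma gf_one mu : (forall z, 0 <= mu z) ->
  gf mu (fun=> 1%R) = \esum_(z in [set: pop]) mu z.
Proof. by move=> mul; apply: eq_esum => z _; rewrite mon_cst expr1n mule1. Qed.

Lemma gf_le1 mu s : is_law mu -> in_cube s -> gf mu s <= 1.
Proof.
move=> mul s01; have [mu0 <-] := mul; rewrite -gf_one//.
exact: le_gf.
Qed.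

Lemma gf_fin mu s : is_law mu -> in_cube s -> gf mu s = (fine (gf mu s))%:E.
Proof.
move=> mul s01; rewrite fineK// ge0_fin_numE ?gf_ge0//.
by rewrite (le_lt_trans (gf_le1 mul s01)) ?ltry.
Qed.

Lemma fine_gf_cube f s : (forall i, is_law (f i)) -> in_cube s ->
  in_cube (fun i => fine (gf (f i) s)).
Proof.
move=> fl s01 i; rewrite fine_ge0 ?gf_ge0//= -lee_fin -gf_fin//.
exact: gf_le1.
Qed.

Lemma gf_dirac z s : in_cube s -> gf (dirac_law R z) s = (mon s z)%:E.
Proof.
move=> s01; rewrite /gf (esumID [set z])//; last first.
  by move=> x _; rewrite mule_ge0 ?lee_fin ?mon_ge0.
rewrite setTI esum_set1 ?mule_ge0 ?lee_fin ?mon_ge0//.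
rewrite /dirac_law eqxx mul1e esum1 ?adde0// => x [_ /= /eqP xz].
by rewrite eq_sym (negbTE xz) mul0e.
Qed.

Lemma in_cube1 : in_cube (fun=> 1%R).
Proof. by move=> i; rewrite ler01 lexx. Qed.
Local Hint Resolve in_cube1 : core.

Lemma dirac_is_law z : is_law (dirac_law R z).
Proof.
have ge0 x : 0 <= dirac_law R z x by rewrite lee_fin.
by split => //; rewrite -gf_one// gf_dirac// mon_cst expr1n.
Qed.

Lemma conv_law_ge0 mu nu z : is_law mu -> is_law nu -> 0 <= conv_law mu nu z.
Proof. by move=> mul nul; apply: esum_ge0 => x _; rewrite mule_ge0// law_ge0. Qed.

(** Both sides are the sum over all pairs of populations, grouped on the left by the fibres [J z] of
    the addition map. *)
Lemma gf_conv mu nu s : is_law mu -> is_law nu -> in_cube s ->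
  gf (conv_law mu nu) s = gf mu s * gf nu s.
Proof.
move=> mul nul s01.
pose J z := [set x : pop * pop | (x.1 `+` x.2)%mset = z].
pose a (x : pop * pop) := mu x.1 * nu x.2 * (mon s (x.1 `+` x.2)%mset)%:E.
have a0 x : 0 <= a x by rewrite !mule_ge0 ?law_ge0 ?lee_fin ?mon_ge0.
transitivity (\esum_(z in [set: pop]) \esum_(x in J z) a x).
  apply: eq_esum => z _; rewrite muleC -ge0_esumZl ?mon_ge0//; last first.
    by move=> x; rewrite mule_ge0// law_ge0.
  by apply: eq_esum => x /= Jx; rewrite /a Jx muleC.
rewrite esum_esum//.
rewrite (@reindex_esum _ _ _ ([set: pop] `*`` (fun=> [set: pop])) _
  (fun x => ((x.1 `+` x.2)%mset, x)))/=; last first.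
  split => //= [[? ?] [? ?] _ _ [_ -> ->]//|[z [x y]] [_ /= <-]].
  by exists (x, y).
rewrite (eq_esum (b := fun x => a (x.1, x.2))); last by case.
rewrite -(@esum_esum _ _ _ _ _ (fun y z => a (y, z)))//.
rewrite muleC [X in X * _]gf_fin//.
rewrite -ge0_esumZl; last 2 first.
- by rewrite fine_ge0// gf_ge0.
- by move=> x; exact: gf_term_ge0.
apply: eq_esum => y _.
rewrite -gf_fin// muleC (law_fin y)// -EFinM -ge0_esumZl; last 2 first.
- by rewrite mulr_ge0 ?fine_law_ge0 ?mon_ge0.
- by move=> x; exact: gf_term_ge0.
apply: eq_esum => z _; rewrite /a/= monD !EFinM -law_fin//.
by rewrite muleACA.
Qed.

Lemma conv_is_law mu nu : is_law mu -> is_law nu -> is_law (conv_law mu nu).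
Proof.
move=> mul nul; have ge0 z := conv_law_ge0 z mul nul.
split => //; rewrite -gf_one// gf_conv// !gf_one; try by move=> z; exact: law_ge0.
by rewrite mul.2 nul.2 mule1.
Qed.

Lemma branch_is_law f z : (forall i, is_law (f i)) -> is_law (branch f z).
Proof.
move=> fl; rewrite /branch; elim: (enum_mset z) => [|i l ih] /=.
  exact: dirac_is_law.
exact: conv_is_law.
Qed.

Lemma gf_branch f z s : (forall i, is_law (f i)) -> in_cube s ->
  gf (branch f z) s = (mon (fun i => fine (gf (f i) s)) z)%:E.
Proof.
move=> fl s01; rewrite /branch /mon; elim: (enum_mset z) => [|i l ih] /=.
  by rewrite big_nil gf_dirac// mon0.
rewrite gf_conv//; last first.
  by elim: l {ih} => [|j l ih]; [exact: dirac_is_law|exact: conv_is_law].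
by rewrite ih big_cons [X in X * _]gf_fin// -EFinM.
Qed.

(* Law of the population obtained from one of law [mu] when its individuals are
   independently substituted according to [f]; [replace_law] is an instance. *)
Definition bind_law mu f : law R := fun z =>
  \esum_(r in [set: pop]) (mu r * branch f r z).

Lemma gf_bind mu f s : is_law mu -> (forall i, is_law (f i)) -> in_cube s ->
  gf (bind_law mu f) s = gf mu (fun i => fine (gf (f i) s)).
Proof.
move=> mul fl s01; rewrite /gf /bind_law.
have b0 r z : 0 <= branch f r z by apply: law_ge0; exact: branch_is_law.
have m0 r : 0 <= mu r by exact: law_ge0.
transitivity (\esum_(z in [set: pop]) \esum_(r in [set: pop])
    (mu r * (branch f r z * (mon s z)%:E))).
  apply: eq_esum => z _; rewrite muleC -ge0_esumZl ?mon_ge0//; last first.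
    by move=> r; rewrite mule_ge0.
  by apply: eq_esum => r _; rewrite muleC -!muleA.
rewrite exchange_esum; last first.
  by move=> z r; rewrite !mule_ge0// lee_fin mon_ge0.
apply: eq_esum => r _; rewrite (law_fin r)// ge0_esumZl ?fine_law_ge0//; last first.
  by move=> z; rewrite mule_ge0 ?lee_fin ?mon_ge0.
by rewrite -/(gf (branch f r) s) gf_branch.
Qed.

Lemma bind_is_law mu f : is_law mu -> (forall i, is_law (f i)) ->
  is_law (bind_law mu f).
Proof.
move=> mul fl.
have ge0 z : 0 <= bind_law mu f z.
  by apply: esum_ge0 => r _; rewrite mule_ge0 ?law_ge0//; exact: branch_is_law.
split => //; rewrite -gf_one// gf_bind//.
rewrite (_ : (fun _ => _) = fun=> 1%R); first by rewrite gf_one ?mul.2//; case: mul.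
by apply/funext => i; rewrite gf_one ?(fl i).2//; case: (fl i).
Qed.

End GeneratingFunction.
#[global] Hint Resolve in_cube1 : core.

(** * Laws of the generations and the extinction events *)

Section BranchingProcess.
Variables (R : realType) (d : measure_display) (Omega : measurableType d).

(** Encoding values by [pickle] gives a sequence of disjoint events; integers outside its range
    contribute empty ones. *)
Lemma measure_partition_esum (mu : measure Omega R) (T : countType)
    (X : Omega -> T) (A : set Omega) :
  measurable A -> (forall x, measurable [set w | X w = x]) ->
  mu A = \esum_(x in [set: T]) mu (A `&` [set w | X w = x]).
Proof.
move=> mA mX.
pose F n := A `&` [set w | choice.pickle (X w) = n].
have FE x : F (choice.pickle x) = A `&` [set w | X w = x].
  rewrite /F; congr (_ `&` _); apply/seteqP; split => w /=.
    by move/(pcan_inj choice.pickleK).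
  by move=> ->.
have F0 n : ~ range (choice.pickle : T -> nat) n -> F n = set0.
  by move=> nn; apply/seteqP; split => // w [_ /= wn]; apply: nn; exists (X w).
have mF n : measurable (F n).
  have [[x _ <-]|/F0 ->//] := pselect (range (choice.pickle : T -> nat) n).
  by rewrite FE; apply: measurableI.
have AE : A = \bigcup_n F n.
  by apply/seteqP; split => [w Aw|w [n _ []//]]; exists (choice.pickle (X w)).
rewrite [in LHS]AE measure_bigcup//; last by move=> i j _ _ [w [[_ /= <-] [_ /= <-]]].
rewrite (@eq_eseriesl _ _ xpredT); last by move=> i; rewrite in_setT.
rewrite nneseries_esumT// (esumID (range (choice.pickle : T -> nat)))//.
rewrite setTI [X in _ + X]esum1 ?adde0; last by move=> n [_ /= /F0 ->].
rewrite esum_image; last by move=> x y _ _ /(pcan_inj choice.pickleK).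
by apply: eq_esum => x _; rewrite FE.
Qed.

Variables (P : probability Omega R) (init : law R) (p : nat -> law R).
Variable Z : nat -> Omega -> pop.
Hypothesis Z_bp : branching_process P init p Z.
Hypothesis init_law : is_law init.
Hypothesis p_law : forall i, is_law (p i).

Let mZ n z : measurable [set w | Z n w = z].
Proof. by case: Z_bp. Qed.

Let window l n (h : nat -> pop) :=
  [set w | forall m, (l <= m <= n)%N -> Z m w = h m].

Let measurable_window l n h : measurable (window l n h).
Proof.
rewrite (_ : window l n h = \bigcap_(m in [set m | (l <= m <= n)%N]) [set w | Z m w = h m]).
  by apply: bigcap_measurableType => m _; exact: mZ.
by apply/seteqP; split.
Qed.

(* The Markov property forgets the remote past: summing out Z_l shortens the
   window [l, n] of observed generations to [l + 1, n]. *)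
Let markov_window l n h : (l <= n)%N ->
  P (window l n.+1 h) = P (window l n h) * branch p (h n) (h n.+1).
Proof.
elim: l h => [|l ih] h ln; first by case: Z_bp => _ _; exact.
pose hl y m := if m == l then y else h m.
have windowE k y : (l < k)%N ->
    window l.+1 k h `&` [set w | Z l w = y] = window l k (hl y).
  move=> lk; apply/seteqP; split => w /=.
    move=> [wh Zl] m /andP[lm mk]; rewrite /hl; case: eqVneq => [->//|ml].
    by apply: wh; rewrite mk andbT ltn_neqAle eq_sym ml.
  move=> wh; split => [m /andP[lm mk]|].
    by rewrite wh ?(ltnW lm)// /hl gtn_eqF.
  by rewrite wh ?leqnn ?(ltnW lk)// /hl eqxx.
have pE k : (l < k)%N ->
    P (window l.+1 k h) = \esum_(y in [set: pop]) P (window l k (hl y)).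
  move=> lk; rewrite (@measure_partition_esum _ pop (Z l))//.
  by apply: eq_esum => y _; rewrite windowE.
rewrite !pE ?ltnS//; last exact: ltnW.
rewrite [RHS]muleC (law_fin (h n.+1) (branch_is_law (h n) p_law)).
rewrite -ge0_esumZl//; last first.
  by apply/fine_law_ge0/branch_is_law.
apply: eq_esum => y _; rewrite ih ?(ltnW ln)// muleC -law_fin; last exact: branch_is_law.
by rewrite /hl !gtn_eqF// ltnW.
Qed.

Definition gen_law n : law R := fun z => P [set w | Z n w = z].

Lemma gen_law0 : gen_law 0 = init.
Proof. by apply/funext => z; case: Z_bp => _ + _; exact. Qed.

Let joint_law n y z :
  P ([set w | Z n.+1 w = z] `&` [set w | Z n w = y]) = gen_law n y * branch p y z.
Proof.
pose h m := if m == n then y else z.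
suff [W1 W2] : window n n h = [set w | Z n w = y] /\
    window n n.+1 h = [set w | Z n.+1 w = z] `&` [set w | Z n w = y].
  by rewrite -W2 /gen_law -W1 markov_window// /h eqxx gtn_eqF.
split; apply/seteqP; split => w /=.
- by move=> /(_ n); rewrite leqnn /h eqxx; apply.
- by move=> Zn m /anti_leq <-; rewrite /h eqxx.
- move=> wh; split; first by rewrite (wh n.+1) ?leqnSn ?leqnn// /h gtn_eqF.
  by rewrite (wh n) ?leqnSn ?leqnn// /h eqxx.
- move=> [ZS Zn] m; rewrite leq_eqVlt => /andP[/orP[/eqP <-|nm] mn].
    by rewrite /h eqxx.
  by rewrite (_ : m = n.+1) /h ?gtn_eqF//; apply/eqP; rewrite eqn_leq mn.
Qed.

Lemma gen_lawS n : gen_law n.+1 = bind_law (gen_law n) p.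
Proof.
apply/funext => z; rewrite /gen_law (@measure_partition_esum _ pop (Z n))//.
apply: eq_esum => y _; exact: joint_law.
Qed.

Lemma gen_law_is_law n : is_law (gen_law n).
Proof.
elim: n => [|n ih]; first by rewrite gen_law0.
by rewrite gen_lawS; exact: bind_is_law.
Qed.

(** Integers carry the discrete topology, so sizes that tend to 0 are eventually 0. *)
Lemma extinctionE :
  extinction Z = \bigcup_N \bigcap_(n in [set n | (N <= n)%N]) [set w | Z n w = mset0].
Proof.
apply/seteqP; split => w /=.
  rewrite /extinction/= => /(_ [set 0%N]).
  rewrite nbhs_principalE; case => [//|N _ sub]; exists N => // n /= /sub/=.
  by move/eqP; rewrite size_mset_eq0 => /eqP.
move=> [N _ wN]; apply: cvg_near_cst; exists N => // n /= Nn.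
by rewrite (wN n Nn) enum_mset0.
Qed.

Lemma measurable_extinction : measurable (extinction Z).
Proof.
rewrite extinctionE; apply: bigcup_measurable => N _.
by apply: bigcap_measurableType => n _; exact: mZ.
Qed.

(* The empty population is absorbing, up to a null set. *)
Lemma extinct_le_extinction n : gen_law n mset0 <= P (extinction Z).
Proof.
(* [B m] is a resurrection after generation m; it is null because [branch] sends the empty
   population to itself. *)
pose B m := [set w | Z m w = mset0] `\` [set w | Z m.+1 w = mset0].
have mB m : measurable (B m) by apply: measurableD; exact: mZ.
have B0 m : P (B m) = 0.
  rewrite measureD//; last by rewrite (le_lt_trans (probability_le1 _ _)) ?ltry.
  rewrite [X in _ - X](_ : _ = gen_law m mset0).
    by rewrite subee// fin_num_measure//; exact: mZ.
  rewrite setIC [LHS](joint_law m mset0 mset0).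
  by rewrite /branch enum_mset0/= /dirac_law eqxx mule1.
have mUB : measurable (\bigcup_m B m) by exact: bigcup_measurable.
have UB0 : P (\bigcup_m B m) = 0.
  apply/eqP; rewrite -measure_le0.
  apply: (le_trans (measure_sigma_subadditive _ mB mUB (@subset_refl _ _))).
  by rewrite eseries0// => i _ _; exact: B0.
have ZnB : [set w | Z n w = mset0] `<=` extinction Z `|` \bigcup_m B m.
  move=> w /= Zn; have [|nB] := pselect ((\bigcup_m B m) w); [by right|left].
  rewrite extinctionE; exists n => // m /= /subnK <-.
  elim: (m - n)%N => [//|k ih]; apply: contrapT => nZ; apply: nB.
  by exists (k + n)%N.
rewrite -[leRHS]adde0 -UB0.
apply: le_trans (measureU2 _ measurable_extinction mUB).
apply: le_measure ZnB; rewrite inE; first exact: mZ.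
by apply: measurableU => //; exact: measurable_extinction.
Qed.

(** Extinction is the increasing union of the events [F N], each contained in Z_N = 0; continuity
    from below concludes. *)
Lemma extinction_le (c : \bar R) :
  (forall n, gen_law n mset0 <= c) -> P (extinction Z) <= c.
Proof.
move=> le_c; rewrite extinctionE.
pose F N := \bigcap_(n in [set n | (N <= n)%N]) [set w | Z n w = mset0].
have mF N : measurable (F N) by apply: bigcap_measurableType => n _; exact: mZ.
have homF : {homo F : n m / (n <= m)%N >-> (n <= m)%O}.
  by move=> n m nm; apply/subsetPset => w wn k /= mk; apply: wn; apply: leq_trans mk.
have := nondecreasing_cvg_mu (mu := P) mF (bigcup_measurable (fun N _ => mF N)) homF.
move=> /cvg_lim <-//; apply: lime_le.
  by apply/cvg_ex; eexists; apply: nondecreasing_cvg_mu => //; exact: bigcup_measurable.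
apply: nearW => N /=; apply: le_trans (le_c N); apply: le_measure; rewrite ?inE//.
by move=> w /(_ N); apply => /=.
Qed.

Lemma extinction_sub_partial : extinction Z `<=` partial_extinction Z.
Proof.
move=> w; rewrite extinctionE => -[N _ wN] l.
by apply: cvg_near_cst; exists N => // n /= Nn; rewrite (wN n Nn) mset0E.
Qed.

(** Populations are countable, so the absence of type l in generation n is a countable union of
    measurable events. *)
Lemma measurable_partial_extinction : measurable (partial_extinction Z).
Proof.
rewrite (_ : partial_extinction Z = \bigcap_l \bigcup_N
    \bigcap_(n in [set n | (N <= n)%N])
      \bigcup_(z in [set z : pop | z l = 0%N]) [set w | Z n w = z]).
  apply: bigcap_measurableType => l _; apply: bigcup_measurable => N _.
  apply: bigcap_measurableType => n _; rewrite bigcup_mkcond.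
  apply: countable_bigcupT_measurable => [|z]; last by case: ifP.
  exact: countableP.
apply/seteqP; split => w /=.
  move=> wp l _; have := wp l [set 0%N].
  rewrite nbhs_principalE; case => [//|N _ sub]; exists N => // n /= /sub/= Zl.
  by exists (Z n w).
move=> wp l; have [//|N _ wN] := wp l.
by apply: cvg_near_cst; exists N => // n /= /wN [z /= zl ->].
Qed.

Lemma extinction_le_partial : P (extinction Z) <= P (partial_extinction Z).
Proof.
apply: le_measure; rewrite ?inE; first exact: measurable_extinction.
  exact: measurable_partial_extinction.
exact: extinction_sub_partial.
Qed.

End BranchingProcess.

(** * Iterates of the offspring generating function, with and without frozen types *)

Section Iterates.
Local Open Scope ring_scope.
Variables (R : realType) (p : nat -> law R).
Hypothesis p_law : forall i, is_law (p i).
Implicit Types (s t x y : nat -> R) (c e : R).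

Definition offspring_gf s : nat -> R := fun j => fine (gf (p j) s).
Local Notation G := offspring_gf.

Lemma offspring_gfE s j : in_cube s -> (G s j)%:E = gf (p j) s.
Proof. by move=> s01; rewrite -gf_fin. Qed.

Lemma offspring_gf_cube s : in_cube s -> in_cube (G s).
Proof. exact: fine_gf_cube. Qed.

Lemma le_offspring_gf s t j : in_cube s -> in_cube t ->
  (forall i, s i <= t i) -> G s j <= G t j.
Proof.
move=> s01 t01 st; rewrite -lee_fin !offspring_gfE//; apply: le_gf => // i.
by rewrite st andbT; case/andP: (s01 i).
Qed.

Lemma cvg_mon (x : nat -> nat -> R) y z :
  (forall j, x k j @[k --> \oo] --> y j) -> mon (x k) z @[k --> \oo] --> mon y z.
Proof.
move=> xy; rewrite /mon; elim: (enum_mset z) => [|i l ih].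
  by under eq_fun do rewrite big_nil; rewrite big_nil; exact: cvg_cst.
by under eq_fun do rewrite big_cons; rewrite big_cons; apply: cvgM.
Qed.

(** G is a supremum of finite partial sums, each a polynomial and hence continuous; one of them
    already exceeds c at y. *)
Lemma offspring_gf_lsc (x : nat -> nat -> R) y j c :
  (forall k, in_cube (x k)) -> in_cube y ->
  (forall i, x k i @[k --> \oo] --> y i) -> c < G y j ->
  \forall k \near \oo, c < G (x k) j.
Proof.
move=> x01 y01 xy; rewrite -lte_fin offspring_gfE//.
move=> /ereal_sup_gt[_ [A [finA _] <-]].
have finE s : in_cube s -> (\sum_(z \in A) (p j z * (mon s z)%:E))%E =
    (\sum_(z <- fset_set A) fine (p j z) * mon s z)%:E.
  move=> s01; rewrite fsbig_finite//= -sumEFin; apply: eq_bigr => z _.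
  by rewrite EFinM -law_fin.
rewrite finE// lte_fin => cA.
have : \sum_(z <- fset_set A) fine (p j z) * mon (x k) z @[k --> \oo] -->
    \sum_(z <- fset_set A) fine (p j z) * mon y z.
  elim: (enum_fset (fset_set A)) => [|z l ih].
    by under eq_fun do rewrite big_nil; rewrite big_nil; exact: cvg_cst.
  under eq_fun do rewrite big_cons; rewrite big_cons; apply: cvgD => //.
  by apply: cvgM; [exact: cvg_cst|exact: cvg_mon].
move=> /cvgr_gt/(_ _ cA); apply: filterS => k ck.
rewrite -lte_fin offspring_gfE//; apply: lt_le_trans (_ : _ < _)%E _.
  by rewrite -(lte_fin) in ck; exact: ck.
by rewrite -finE//; apply: ereal_sup_ubound; exists A.
Qed.

(* Probability generating function, at the vector equal to 0 below k and to c
   from k on, of generation n of the process in which the types from k on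
   are frozen: [pinned k c n i] is E_i[c ^ (frozen individuals)] on the event
   that all individuals of generation n are frozen. *)
Fixpoint pinned k c n : nat -> R := fun j =>
  if (j < k)%N then (if n is m.+1 then G (pinned k c m) j else 0) else c.

(** The probability, started from a given type, that generation n is empty. *)
Definition ext_iter n : nat -> R := iter n G (fun=> 0).

Lemma pinnedF k c n j : (k <= j)%N -> pinned k c n j = c.
Proof. by move=> kj; case: n => [|n] /=; rewrite ltnNge kj. Qed.

Lemma pinned_cube k c n : 0 <= c <= 1 -> in_cube (pinned k c n).
Proof.
move=> c01; elim: n => [|n ih] j /=; case: ifP => // _; first by rewrite lexx ler01.
exact: offspring_gf_cube.
Qed.

Lemma in_cube0 : in_cube (fun=> 0 : R).
Proof. by move=> i; rewrite lexx ler01. Qed.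

Lemma ext_iter_cube n : in_cube (ext_iter n).
Proof. by elim: n => [|n ih]; [exact: in_cube0|exact: offspring_gf_cube]. Qed.

Lemma ext_iter_nondecreasing n i : ext_iter n i <= ext_iter n.+1 i.
Proof.
elim: n i => [|n ih] i; first by case/andP: (ext_iter_cube 1 i).
by apply: le_offspring_gf (ext_iter_cube n) (ext_iter_cube n.+1) _.
Qed.

Lemma le_ext_iter n m i : (n <= m)%N -> ext_iter n i <= ext_iter m i.
Proof.
move: n m; apply/(@nondecreasing_seqP _ _ (ext_iter^~ i)) => n.
exact: ext_iter_nondecreasing.
Qed.

Lemma pinned_nondecreasing k c n i : 0 <= c <= 1 -> pinned k c n i <= pinned k c n.+1 i.
Proof.
move=> c01; elim: n i => [|n ih] i.
  rewrite /=; case: ifP => // _.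
  by case/andP: (offspring_gf_cube (pinned_cube k 0 c01) i).
rewrite [leLHS]/= [leRHS]/=; case: ifP => // ik.
by apply: le_offspring_gf (pinned_cube k n c01) (pinned_cube k n.+1 c01) _.
Qed.

Lemma le_pinned k c n m i : 0 <= c <= 1 -> (n <= m)%N ->
  pinned k c n i <= pinned k c m i.
Proof.
move=> c01; move: n m; apply/(@nondecreasing_seqP _ _ ((pinned k c)^~ i)) => n.
exact: pinned_nondecreasing.
Qed.

(** At c = 0 only those extinctions count in which no type from k on has occurred. *)
Lemma pinned0_le_ext_iter k n i : pinned k 0 n i <= ext_iter n i.
Proof.
elim: n i => [|n ih] i /=; first by case: ifP.
case: ifP => _; last by case/andP: (ext_iter_cube n.+1 i).
apply: le_offspring_gf => //; last exact: ext_iter_cube.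
by apply: pinned_cube; rewrite lexx ler01.
Qed.

(** By induction on n: the upper bound holds for every k, and lower semicontinuity of G gives the
    lower one. *)
Lemma cvg_pinned0 n i : pinned k 0 n i @[k --> \oo] --> ext_iter n i.
Proof.
elim: n i => [|n ih] i.
  by apply: cvg_near_cst; apply: nearW => k /=; case: ifP.
apply/cvgrPdist_le => e e0; near=> k.
have ik : (i < k)%N by near: k; exists i.+1.
rewrite ler_distlC; apply/andP; split; last first.
  by rewrite (le_trans (pinned0_le_ext_iter _ _ _))// lerDl ltW.
rewrite /= ik; apply: ltW; near: k.
apply: (@offspring_gf_lsc (fun k => pinned k 0 n) (ext_iter n)) => //.
  by move=> k; apply: pinned_cube; rewrite lexx ler01.
  exact: ext_iter_cube.
by rewrite ltrBlDr ltrDl.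
Unshelve. all: by end_near. Qed.

(** A frozen individual reproduces exactly itself. This exhibits [pinned k c n i] as a generating
    function whose law does not depend on c, so that different values of c can be compared
    population by population. *)
Let frozen k j : law R := if (j < k)%N then p j else dirac_law R [mset j]%mset.

Let frozen_gen k n : nat -> law R :=
  iter n (fun f i => bind_law (frozen k i) f) (fun i => dirac_law R [mset i]%mset).

Let frozen_is_law k j : is_law (frozen k j).
Proof. by rewrite /frozen; case: ifP => // _; exact: dirac_is_law. Qed.

Let frozen_gen_is_law k n i : is_law (frozen_gen k n i).
Proof.
by elim: n i => [|n ih] i; [exact: dirac_is_law|exact: bind_is_law].
Qed.

Let pinnedE k c n i : 0 <= c <= 1 ->
  (pinned k c n i)%:E = gf (frozen_gen k n i) (pinned k c 0).
Proof.
move=> c01; have p01 := pinned_cube k 0 c01.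
elim: n i => [|n ih] i; first by rewrite gf_dirac// mon1.
rewrite [frozen_gen _ _ _]/= gf_bind//.
rewrite [X in gf _ X](_ : _ = pinned k c n); last first.
  by apply/funext => j; rewrite -ih.
have pn01 := pinned_cube k n c01.
rewrite /frozen [in LHS]/=; case: ifP => [_|/negbT]; first by rewrite -offspring_gfE.
by rewrite -leqNgt => ki; rewrite gf_dirac// mon1 pinnedF.
Qed.

Let mon_pinned k c z : mon (pinned k c 0) z =
  if all (leq k) (enum_mset z) then c ^+ size (enum_mset z) else 0.
Proof.
rewrite /mon; elim: (enum_mset z) => [|i l ih]; first by rewrite big_nil.
rewrite big_cons ih /= (leqNgt k i); case: ifP => _ /=; first by rewrite mul0r.
by case: ifP => _; rewrite ?mulr0// exprS.
Qed.

(* Termwise c ^ N <= [N = 0] + c ^ m + [N > 0] eps ^ (N - m), where N is the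
   number of frozen individuals; the subtraction is moved across. *)
Lemma pinned_interpolation k c e n m i : 0 <= c <= 1 -> 0 < e <= 1 ->
  pinned k c n i + e ^- m * pinned k 0 n i <=
  pinned k 0 n i + c ^+ m + e ^- m * pinned k e n i.
Proof.
move=> c01 /andP[e0 e1].
have e01 : 0 <= e <= 1 by rewrite ltW.
have z01 : 0 <= (0 : R) <= 1 by rewrite lexx ler01.
have [c0 c1] := andP c01.
have em0 : 0 <= e ^- m by rewrite invr_ge0 exprn_ge0// ltW.
have cm0 : 0 <= c ^+ m by rewrite exprn_ge0.
have fl := frozen_gen_is_law k n i.
have ge0 u z : 0 <= u <= 1 -> (0 <= frozen_gen k n i z * (mon (pinned k u 0) z)%:E)%E.
  by move=> u01; apply: gf_term_ge0 => //; exact: pinned_cube.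
have ge0' u z : 0 <= u <= 1 ->
    (0 <= (e ^- m)%:E * (frozen_gen k n i z * (mon (pinned k u 0) z)%:E))%E.
  by move=> u01; rewrite mule_ge0// ge0.
rewrite -lee_fin !EFinD !EFinM !pinnedE//.
(* The masses sum to 1, so the constant c ^ m also becomes a sum over populations. *)
have -> : (c ^+ m)%:E = (\esum_(z in [set: pop]) ((c ^+ m)%:E * frozen_gen k n i z))%E.
  by rewrite ge0_esumZl// ?fl.2 ?mule1// => z; exact: law_ge0.
rewrite -!ge0_esumZl//; try by move=> z; exact: ge0.
have ge0c z : (0 <= (c ^+ m)%:E * frozen_gen k n i z)%E.
  by rewrite mule_ge0// law_ge0.
rewrite -!esumD//; try by move=> z _; rewrite ?adde_ge0 ?ge0 ?ge0'.
apply: le_esum => z _; rewrite (law_fin z fl).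
set w := fine _; have w0 : 0 <= w by apply: fine_law_ge0.
rewrite -!EFinM -!EFinD lee_fin.
rewrite !(mulrCA _ w) (mulrC _ w) -!mulrDr; apply: ler_wpM2l => //.
rewrite !mon_pinned; case: ifP => _; last by rewrite !mulr0 !addr0 add0r.
case: (size _) => [|N].
  by rewrite !expr0 lerD2r lerDl.
rewrite expr0n/= mulr0 addr0 add0r.
have [Nm|mN] := leqP N.+1 m; last first.
  apply: (@le_trans _ _ (c ^+ m)); first exact/ler_wiXn2l/ltnW.
  by rewrite lerDl mulr_ge0// exprn_ge0// ltW.
apply: (@le_trans _ _ 1); first by rewrite exprn_ile1.
apply: (@le_trans _ _ (e ^- m * e ^+ N.+1)); last by rewrite lerDr.
rewrite ler_pdivlMl ?exprn_gt0// mulr1.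
by apply: ler_wiXn2l => //; exact: ltW.
Qed.

Section Limit.
Variables (q : nat -> R) (e : R) (K : nat).
(** Together with [q_least], this makes [q] the pointwise supremum of the iterates. *)
Hypothesis ext_iter_le : forall n i, ext_iter n i <= q i.
Hypothesis q_least : forall i c, (forall n, ext_iter n i <= c) -> q i <= c.
Hypothesis e_gt0 : 0 < e.
Hypothesis e_le : forall l, (K <= l)%N -> e <= q l.

Lemma q_cube : in_cube q.
Proof.
move=> i; apply/andP; split; first exact: (ext_iter_le 0).
by apply: q_least => n; case/andP: (ext_iter_cube n i).
Qed.

Lemma ext_iter_gt i c : c < q i -> exists n, c < ext_iter n i.
Proof.
move=> cq; apply: contrapT => nc; move: cq; apply/negP; rewrite -leNgt.
by apply: q_least => n; rewrite leNgt; apply/negP => cn; apply: nc; exists n.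
Qed.

Lemma cvg_ext_iter i : ext_iter n i @[n --> \oo] --> q i.
Proof.
apply/cvgrPdist_le => d d0.
have [|N dN] := @ext_iter_gt i (q i - d); first by rewrite ltrBlDr ltrDl.
exists N => // n /= Nn; rewrite ler_distlC (ltW (lt_le_trans dN _)) ?le_ext_iter//=.
by rewrite (le_trans (ext_iter_le _ _))// lerDl ltW.
Qed.

(** Monotonicity of G gives one inequality. For the other, if G q i exceeded q i then, by lower
    semicontinuity, so would G (ext_iter N) i, which is the next iterate. *)
Lemma q_fixpoint i : q i = G q i.
Proof.
apply/eqP; rewrite eq_le; apply/andP; split.
  apply: q_least => n; apply: le_trans (ext_iter_nondecreasing _ _) _.
  by apply: le_offspring_gf => //; [exact: ext_iter_cube|exact: q_cube].
rewrite leNgt; apply/negP => qG.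
have [N _ /(_ N (leqnn N))/=] := offspring_gf_lsc ext_iter_cube q_cube cvg_ext_iter qG.
by apply/negP; rewrite -leNgt; exact: (ext_iter_le N.+1).
Qed.

Lemma pinned_le_q k n i : (K <= k)%N -> pinned k e n i <= q i.
Proof.
have e01 : 0 <= e <= 1.
  rewrite ltW//= (le_trans (e_le (leqnn K)))//; exact: (andP (q_cube K)).2.
move=> Kk; elim: n i => [|n ih] i /=; case: ltnP => ik //.
- exact: (andP (q_cube i)).1.
- by apply: e_le; exact: leq_trans ik.
- by rewrite q_fixpoint; apply: le_offspring_gf => //; [exact: pinned_cube|exact: q_cube].
- by apply: e_le; exact: leq_trans ik.
Qed.

Lemma pinned0_near i d : 0 < d ->
  exists n, \forall k \near \oo, q i - d <= pinned k 0 n i.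
Proof.
move=> d0; have [|n dn] := @ext_iter_gt i (q i - d); first by rewrite ltrBlDr ltrDl.
exists n; have /cvgr_gt/(_ _ dn) := @cvg_pinned0 n i.
by apply: filterS => k /ltW.
Qed.

(** The threshold on k must not depend on n, because all generations are later bounded at one and
    the same k. *)
Lemma pinned_near i c d : 0 <= c < 1 -> 0 < d ->
  \forall k \near \oo, forall n, pinned k c n i <= q i + d.
Proof.
move=> /andP[c0 c1] d0; have c01 : 0 <= c <= 1 by rewrite c0 ltW.
have e01 : 0 < e <= 1.
  rewrite e_gt0 (le_trans (e_le (leqnn K)))//; exact: (andP (q_cube K)).2.
have z01 : 0 <= (0 : R) <= 1 by rewrite lexx ler01.
(* The exponent m is fixed first; the level is then taken so large that the gap between [pinned] at
   e and at 0, even when multiplied by e ^ -m, is at most d / 2. *)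
have [m cm] : exists m, c ^+ m <= d / 2.
  have /cvg_expr/cvgrPdist_le/(_ _ (divr_gt0 d0 (ltr0Sn R 1))) : `|c| < 1.
    by rewrite ger0_norm.
  move=> [m _ /(_ m (leqnn m))/=].
  by rewrite sub0r normrN ger0_norm ?exprn_ge0//; exists m.
have em0 : 0 < e ^+ m by rewrite exprn_gt0.
have [n0 [K0 _ near0]] := pinned0_near i (mulr_gt0 em0 (divr_gt0 d0 (ltr0Sn R 1))).
exists (maxn K K0) => // k /=; rewrite geq_max => /andP[Kk K0k] n.
(* Since [pinned] increases with the generation, n may be raised to a generation where the lower
   bound [near0] applies. *)
pose m' := maxn n n0.
apply: le_trans (le_pinned k i c01 (leq_maxl n n0)) _; rewrite -/m'.
have := pinned_interpolation k m' m i c01 e01.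
have h0 : q i - e ^+ m * (d / 2) <= pinned k 0 m' i.
  by apply: le_trans (near0 k K0k) _; exact: le_pinned (leq_maxr _ _).
have h1 : pinned k 0 m' i <= q i.
  by apply: le_trans (pinned0_le_ext_iter _ _ _) _; exact: ext_iter_le.
have h2 : e ^- m * (pinned k e m' i - pinned k 0 m' i) <= d / 2.
  rewrite ler_pdivrMl//.
  have := pinned_le_q m' i Kk; lra.
rewrite mulrBr in h2; lra.
Qed.

End Limit.
End Iterates.

(** * Generations as iterates, extinction probability 1 along paths, and replacement *)

Section Replacement.
Local Open Scope ring_scope.
Variables (R : realType) (p : nat -> law R).
Hypothesis p_law : forall i, is_law (p i).
Implicit Types (s t : nat -> R).

Lemma gf_zero (mu : law R) : is_law mu -> gf mu (fun=> 0) = mu mset0.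
Proof.
move=> mul; have h := @gf_term_ge0 R mu (fun=> 0) _ mul (@in_cube0 R).
rewrite /gf (esumID [set mset0])// setTI esum_set1// mon0 mule1 esum1 ?adde0//.
move=> z [_ /= /eqP z0]; rewrite mon_cst expr0n.
by move: z0; rewrite -size_mset_eq0 => /negbTE ->; rewrite mule0.
Qed.

Lemma gf_gen_law d (Omega : measurableType d) (P : probability Omega R)
    (init : law R) Z n s :
  branching_process P init p Z -> is_law init -> in_cube s ->
  gf (gen_law P Z n) s = gf init (iter n (offspring_gf p) s).
Proof.
move=> Zp initl; elim: n s => [|n ih] s s01; first by rewrite (gen_law0 Zp).
rewrite (gen_lawS Zp)// gf_bind//; last exact: gen_law_is_law Zp _ _ _.
by rewrite iterSr -ih//; exact: offspring_gf_cube.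
Qed.

Lemma gen_law_mset0 d (Omega : measurableType d) (P : probability Omega R)
    (init : law R) Z n : branching_process P init p Z -> is_law init ->
  gen_law P Z n mset0 = gf init (ext_iter p n).
Proof.
move=> Zp initl; rewrite -gf_zero; last exact: gen_law_is_law Zp _ _ _.
by rewrite (gf_gen_law _ Zp)//; exact: in_cube0.
Qed.

Lemma mon_le_coord s (z : pop) v : in_cube s -> v \in enum_mset z -> mon s z <= s v.
Proof.
move=> s01 vz; rewrite /mon (perm_big _ (perm_to_rem vz)) big_cons.
have [s0 s1] := andP (s01 v); rewrite ler_piMr//.
by apply: prodr_ile1.
Qed.

(** A mean of monomials equal to 1 forces s ^ r = 1 for each litter r of positive probability, and
    some such litter contains v. *)
Lemma fixpoint1_child s u v : in_cube s -> s = offspring_gf p s ->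
  (0 < mean p u v)%E -> s u = 1 -> s v = 1.
Proof.
move=> s01 sG uv su.
have [r [pr vr]] : exists r : pop, (0 < p u r)%E /\ v \in enum_mset r.
  apply: contrapT => nr; move: uv; rewrite /mean esum1 ?ltxx// => r _.
  have := law_ge0 r (p_law u); rewrite le_eqVlt => /orP[/eqP <-|pr]; first by rewrite mul0e.
  rewrite (_ : r v = 0%N) ?mule0//; apply/eqP; rewrite mset_eq0.
  by apply/negP => vr; apply: nr; exists r.
have pu := p_law u.
have gf1 : gf (p u) s = 1%E by rewrite -offspring_gfE// -sG su.
have ge0 z : (0 <= p u z * (1 - mon s z)%:E)%E.
  by rewrite mule_ge0 ?law_ge0// lee_fin subr_ge0 mon_le1.
(* The mean of 1 - s ^ r is zero and its terms are nonnegative, so each of them vanishes. *)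
have : (gf (p u) s + \esum_(z in [set: pop]) (p u z * (1 - mon s z)%:E) = 1)%E.
  rewrite -esumD//; last by move=> z _; exact: gf_term_ge0.
  rewrite -[RHS]pu.2; apply: eq_esum => z _.
  by rewrite (law_fin z pu) -!EFinM -EFinD -mulrDr addrC subrK mulr1.
have := @esum_ge1 R _ [set: pop] (fun z => p u z * (1 - mon s z)%:E)%E r I.
rewrite gf1; case: (esum _ _) => [x pr0 [x0]|_ //|]; last by rewrite leeNy_eq.
have {x0} x0 : x = 0 by lra.
rewrite {x}x0 in pr0.
have : (p u r * (1 - mon s r)%:E)%E = 0%E by apply/eqP; rewrite eq_le pr0 ge0.
move=> /eqP; rewrite mule_eq0 gt_eqF//= eqe subr_eq0 => /eqP m1.
apply/eqP; rewrite eq_le; have [_ ->] := andP (s01 v); rewrite /= m1.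
exact: mon_le_coord.
Qed.

Lemma fixpoint1_path s u v : in_cube s -> s = offspring_gf p s ->
  has_path p u v -> s u = 1 -> s v = 1.
Proof.
move=> s01 sG [l [pl <-]]; elim: l u pl => [//|x l ih] u /= /andP[ux xl] su.
by apply: ih => //; apply: fixpoint1_child ux su.
Qed.

(** * Comparison of the replaced and frozen processes at a fixed level *)

Section Level.
Variables (k : nat) (alpha : 'I_k -> R).
Hypothesis alpha_distr : is_distribution alpha.

Definition replace_gf s : nat -> R := fun j =>
  if (j < k)%N then s j else \sum_(l < k) alpha l * s l.

Lemma gf_replace1 s j : in_cube s -> gf (replace1 alpha j) s = (replace_gf s j)%:E.
Proof.
move=> s01; rewrite /gf /replace1 /replace_gf; case: ifP => _.
  by rewrite -[LHS]/(gf (dirac_law R [mset j]%mset) s) gf_dirac// mon1.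
have ge0 z l : (0 <= dirac_law R [mset val l]%mset z * (mon s z)%:E)%E.
  by apply: gf_term_ge0 => //; exact: dirac_is_law.
have [a0 _] := alpha_distr.
transitivity (\esum_(z in [set: pop]) \sum_(l < k)
    ((alpha l)%:E * (dirac_law R [mset val l]%mset z * (mon s z)%:E)))%E.
  apply: eq_esum => z _; rewrite ge0_sume_distrl; last first.
    by move=> l _; rewrite mule_ge0// ?lee_fin// law_ge0//; exact: dirac_is_law.
  by apply: eq_bigr => l _; rewrite muleA.
rewrite esum_sum; last by move=> z l _ _; rewrite mule_ge0// lee_fin.
rewrite -sumEFin; apply: eq_bigr => l _.
rewrite ge0_esumZl//.
by rewrite -/(gf (dirac_law R [mset val l]%mset) s) gf_dirac// mon1 EFinM.
Qed.

Lemma replace1_is_law j : is_law (replace1 alpha j).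
Proof.
have ge0 z : (0 <= replace1 alpha j z)%E.
  rewrite /replace1; case: ifP => _; first by rewrite lee_fin.
  by apply: sume_ge0 => l _; rewrite mule_ge0// lee_fin//; exact: alpha_distr.1.
split => //; rewrite -gf_one// gf_replace1// /replace_gf.
case: ifP => // _; under eq_bigr do rewrite mulr1.
by rewrite alpha_distr.2.
Qed.

Lemma replace_gf_cube s : in_cube s -> in_cube (replace_gf s).
Proof.
move=> s01 j; rewrite -!lee_fin -gf_replace1//.
rewrite gf_ge0 ?gf_le1//; exact: replace1_is_law.
Qed.

Local Notation p' := (fun j => replace_law alpha (p j)).

Lemma replace_law_is_law j : is_law (p' j).
Proof. by apply: bind_is_law => // i; exact: replace1_is_law. Qed.

Lemma offspring_gf_replace s : in_cube s ->
  offspring_gf p' s = offspring_gf p (replace_gf s).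
Proof.
move=> s01; apply/funext => j.
rewrite /offspring_gf -[replace_law _ _]/(bind_law (p j) (replace1 alpha)).
rewrite gf_bind//; last exact: replace1_is_law.
congr (fine (gf _ _)); apply/funext => i; by rewrite gf_replace1.
Qed.

(** Types from k on have weight 0 in [pinned], and a nonnegative average as weight under
    replacement. *)
Lemma pinned0_le_replaced n j : (j < k)%N -> pinned p k 0 n j <= ext_iter p' n j.
Proof.
have w01 n' := ext_iter_cube replace_law_is_law n'.
elim: n j => [|n ih] j jk; first by rewrite /= jk.
rewrite -[ext_iter p' n.+1]/(offspring_gf p' (ext_iter p' n)) offspring_gf_replace//.
rewrite /= jk; apply: le_offspring_gf => //.
- by apply: pinned_cube => //; rewrite lexx ler01.
- exact: replace_gf_cube.
- move=> i; have [ik|ki] := ltnP i k; first by rewrite /replace_gf ik ih.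
  rewrite pinnedF//; exact: (andP (replace_gf_cube (w01 n) i)).1.
Qed.

(** By induction, the average weight of a replaced individual is at most the [alpha]-average of
    [pinned], hence at most c, the weight of a frozen one. *)
Lemma replaced_le_pinned c n j : 0 <= c <= 1 ->
  (forall m, \sum_(l < k) alpha l * pinned p k c m l <= c) ->
  (j < k)%N -> ext_iter p' n j <= pinned p k c n j.
Proof.
move=> c01 ac; have w01 n' := ext_iter_cube replace_law_is_law n'.
elim: n j => [|n ih] j jk; first by rewrite /= jk.
rewrite -[ext_iter p' n.+1]/(offspring_gf p' (ext_iter p' n)) offspring_gf_replace//.
rewrite /= jk; apply: le_offspring_gf => //.
- exact: replace_gf_cube.
- exact: pinned_cube.
- move=> i; have [ik|ki] := ltnP i k; first by rewrite /replace_gf ik ih.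
  rewrite pinnedF// /replace_gf ltnNge ki /=; apply: le_trans (ac n).
  by apply: ler_sum => l _; rewrite ler_wpM2l ?alpha_distr.1// ih.
Qed.

End Level.
End Replacement.

(** The lower limit is the supremum of the tail infima, so one of these is positive; the bound by 1
    makes it finite. *)
Lemma limn_einf_gt0 (R : realType) (u : nat -> \bar R) :
  (forall n, u n <= 1) -> 0 < limn_einf u ->
  exists (e : R) (K : nat), (0 < e)%R /\ forall l, (K <= l)%N -> e%:E <= u l.
Proof.
move=> u1; rewrite limn_einf_lim (cvg_lim _ (@cvg_einfs_sup _ u))//.
move=> /ereal_sup_gt[_ [K _ <-] eK].
have le_u l : (K <= l)%N -> einfs u K <= u l.
  by move=> Kl; apply: ereal_inf_lbound; exists l.
have eK_fin : einfs u K \is a fin_num.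
  rewrite ge0_fin_numE ?ltW//.
  by rewrite (le_lt_trans (le_u K (leqnn K)))// (le_lt_trans (u1 K))// ltry.
exists (fine (einfs u K)), K; split; first by rewrite -lte_fin fineK.
by move=> l Kl; rewrite fineK// le_u.
Qed.

(** * Convergence of the extinction probabilities under replacement *)

Theorem theorem1 (R : realType)
  (* the process Z, its progeny laws p, and the family of measures P_i *)
  (p : nat -> law R)
  (p_law : forall i, is_law (p i))
  (p_mean : forall i, \sum_(0 <= j <oo) mean p i j < +oo)
  (d : measure_display) (Omega : measurableType d)
  (P : nat -> probability Omega R) (Z : nat -> Omega -> pop)
  (Z_gw : galton_watson p P Z)
  (* the replacement distributions and the processes bar Z^(k), k >= 1 *)
  (alpha : forall k : nat, 'I_k -> R)
  (alpha_distr : forall k, (1 <= k)%N -> is_distribution (alpha k))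
  (d' : nat -> measure_display) (Omega' : forall k, measurableType (d' k))
  (P' : forall k, nat -> probability (Omega' k) R)
  (Z' : forall k, nat -> Omega' k -> pop)
  (Z'_gw : forall k, (1 <= k)%N ->
     replaced_galton_watson p (alpha k) (P' k) (Z' k))
  (q_liminf : 0 < limn_einf (fun i => P i (extinction Z)))
  (N1 N2 : nat) (a : R)
  (N1_ge1 : (1 <= N1)%N) (N2_ge1 : (1 <= N2)%N) (a_gt0 : (0 < a)%R)
  (alpha_ge : forall k, (1 <= k)%N -> (N2 <= k)%N ->
     (a <= \sum_(j < k | (j < minn N1 k)%N) alpha k j)%R) :
  (forall i : nat,
     (forall j, (j < N1)%N -> P j (partial_extinction Z) < 1) \/
     (forall j, (j < N1)%N ->
        P j (partial_extinction Z) = 1 /\ has_path p j i) ->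
     P' k i (extinction (Z' k)) @[k --> \oo] --> P i (extinction Z))
  /\
  (irreducible p ->
   forall i : nat,
     P' k i (extinction (Z' k)) @[k --> \oo] --> P i (extinction Z)).
Proof.
pose q j := fine (P j (extinction Z)).
have qE j : P j (extinction Z) = (q j)%:E.
  by rewrite /q fineK// fin_num_measure//; exact: measurable_extinction (Z_gw j).
have gen0 n j : gen_law (P j) Z n mset0 = (ext_iter p n j)%:E.
  rewrite (gen_law_mset0 _ _ (Z_gw j))//; last exact: dirac_is_law.
  by rewrite gf_dirac ?mon1//; exact: ext_iter_cube.
have ext_le n j : (ext_iter p n j <= q j)%R.
  by rewrite -lee_fin -qE -gen0; exact: extinct_le_extinction (Z_gw j) p_law n.
have q_least j c : (forall n, ext_iter p n j <= c)%R -> (q j <= c)%R.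
  move=> cn; rewrite -lee_fin -qE; apply: (extinction_le (Z_gw j)).
  by move=> n; rewrite gen0 lee_fin.
have [e [K [e0 eK]]] : exists (e : R) (K : nat),
    (0 < e)%R /\ forall l, (K <= l)%N -> (e <= q l)%R.
  have [|e [K [e0 eK]]] := limn_einf_gt0 _ q_liminf.
    by move=> n; apply: probability_le1; exact: measurable_extinction (Z_gw n).
  by exists e, K; split => // l Kl; rewrite -lee_fin -qE eK.
have q01 := q_cube p_law ext_le q_least.
have qG : q = offspring_gf p q.
  by apply/funext => j; apply: q_fixpoint.
(* The common form of (i), (ii) and irreducibility: it is void when q i = 1. *)
have main i : ((q i < 1)%R -> forall j, (j < N1)%N -> (q j < 1)%R) ->
    P' k i (extinction (Z' k)) @[k --> \oo] --> P i (extinction Z).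
  move=> qlt1; rewrite qE.
  have mext k : (1 <= k)%N -> measurable (extinction (Z' k)).
    by move=> k1; exact: measurable_extinction (Z'_gw _ k1 i).
  have fin' : \forall k \near \oo, P' k i (extinction (Z' k)) \is a fin_num.
    by exists 1%N => // k /= /mext mk; rewrite fin_num_measure.
  apply: cvg_EFin => //.
  pose p' k j := replace_law (alpha k) (p j).
  (* For i < k the initial individual keeps its type. *)
  have gen0' k n : (i < k)%N -> gen_law (P' k i) (Z' k) n mset0 = (ext_iter (p' k) n i)%:E.
    move=> ik; have k1 : (1 <= k)%N by apply: leq_trans ik.
    have ad := alpha_distr _ k1.
    have p'l := replace_law_is_law p_law ad.
    rewrite (gen_law_mset0 _ _ (Z'_gw _ k1 i))//; last exact: replace1_is_law.
    rewrite gf_replace1//; last exact: ext_iter_cube.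
    by rewrite /replace_gf ik.
  have ext_le' k n : (i < k)%N -> (ext_iter (p' k) n i)%:E <= P' k i (extinction (Z' k)).
    move=> ik; have k1 : (1 <= k)%N by apply: leq_trans ik.
    have p'l := replace_law_is_law p_law (alpha_distr _ k1).
    by rewrite -gen0'//; exact: extinct_le_extinction (Z'_gw _ k1 i) p'l n.
  have least' k (c : R) : (i < k)%N -> (forall n, ext_iter (p' k) n i <= c)%R ->
      P' k i (extinction (Z' k)) <= c%:E.
    move=> ik cn; have k1 : (1 <= k)%N by apply: leq_trans ik.
    apply: (extinction_le (Z'_gw _ k1 i)) => n.
    by rewrite gen0'// lee_fin.
  apply/cvgrPdist_le => del del0.
  have upper : \forall k \near \oo, P' k i (extinction (Z' k)) <= (q i + del)%:E.
    have [q1|q1] := leP 1%R (q i).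
      exists 1%N => // k /= /mext mk; rewrite (le_trans (probability_le1 _ mk))//.
      by rewrite lee_fin (le_trans q1)// lerDl ltW.
    pose M := (\big[Num.max/0]_(j < N1) q j)%R.
    have M0 : (0 <= M)%R by exact: bigmax_ge_id.
    have M1 : (M < 1)%R by apply/bigmax_ltP; split => // j _; exact: qlt1.
    have qM j : (j < N1)%N -> (q j <= M)%R.
      by move=> jN; exact: (le_bigmax _ (fun j : 'I_N1 => q j) (Ordinal jN)).
    (* b is the midpoint of M and 1. If mass at least a has weight at most b and the rest at most 1,
       the average is at most c. *)
    pose b := ((1 + M) / 2)%R; pose c := (1 - a * (1 - b))%R.
    have b1 : (b < 1)%R by rewrite /b; lra.
    have b0 : (0 <= b)%R by rewrite /b; lra.
    have c1 : (c < 1)%R by rewrite /c ltrBlDr ltrDl mulr_gt0// subr_gt0.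
    (* Needed for c >= 0; it follows from the mass bound at the single level max N1 N2. *)
    have a1 : (a <= 1)%R.
      have kN : (1 <= maxn N1 N2)%N by rewrite leq_max N1_ge1.
      apply: le_trans (alpha_ge _ kN (leq_maxr _ _)) _.
      have [a0 <-] := alpha_distr _ kN.
      rewrite [leRHS](bigID (fun j : 'I__ => (j < minn N1 (maxn N1 N2))%N))/=.
      by rewrite lerDl; apply: sumr_ge0.
    have c0 : (0 <= c)%R.
      by rewrite subr_ge0; apply: mulr_ile1 => //; first exact: ltW; lra.
    have c01 : (0 <= c <= 1)%R by rewrite c0 ltW.
    have pin_near j eta : (0 < eta)%R -> \forall k \near \oo,
        forall n, (pinned p k c n j <= q j + eta)%R.
      by apply: (pinned_near p_law ext_le q_least e0 eK); rewrite c0.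
    (* Finitely many types j < N1, hence a common threshold on k. *)
    have pin_b : \forall k \near \oo, forall j : 'I_N1, forall n,
        (pinned p k c n j <= b)%R.
      apply: filter_forall => j.
      have /pin_near : (0 < b - M)%R by rewrite /b; lra.
      move=> /(_ j); apply: filterS => k h n; apply: le_trans (h n) _.
      by have := qM j (ltn_ord j); lra.
    near=> k.
    have ik : (i < k)%N by near: k; exists i.+1.
    have k1 : (1 <= k)%N by apply: leq_trans ik.
    have N1k : (N1 <= k)%N by near: k; exists N1.
    have N2k : (N2 <= k)%N by near: k; exists N2.
    have kb : forall j : 'I_N1, forall n, (pinned p k c n j <= b)%R by near: k.
    apply: least' => // n.
    apply: (@le_trans _ _ (pinned p k c n i)); last first.
      by move: n; near: k; exact: pin_near.
    apply: replaced_le_pinned => //; first exact: alpha_distr.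
    move=> m; have [al0 al1] := alpha_distr _ k1.
    have pc := pinned_cube p_law k m c01.
    have := alpha_ge _ k1 N2k; rewrite (minn_idPl N1k) => aS.
    rewrite (bigID (fun l : 'I_k => (l < N1)%N))/=.
    move: al1; rewrite (bigID (fun l : 'I_k => (l < N1)%N))/=.
    set A := (\sum_(l < k | (l < N1)%N) _)%R in aS *.
    set B := (\sum_(l < k | ~~ (l < N1)%N) _)%R => AB.
    have hA : (\sum_(l < k | (l < N1)%N) alpha k l * pinned p k c m l <= A * b)%R.
      rewrite mulr_suml; apply: ler_sum => l lN; rewrite ler_wpM2l//.
      exact: (kb (Ordinal lN)).
    have hB : (\sum_(l < k | ~~ (l < N1)%N) alpha k l * pinned p k c m l <= B)%R.
      apply: ler_sum => l lN; rewrite ler_piMr//; exact: (andP (pc l)).2.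
    (* Since A + B = 1 and a <= A, A b + B = 1 - A (1 - b) <= c. *)
    apply: le_trans (lerD hA hB) _; rewrite /c.
    have : (a * (1 - b) <= A * (1 - b))%R by rewrite ler_wpM2r// subr_ge0 ltW.
    by rewrite !mulrBr !mulr1; lra.
  (* For the lower bound one generation n, chosen before k, is enough. *)
  have [n lower] := pinned0_near p_law q_least i del0.
  near=> k.
  have ik : (i < k)%N by near: k; exists i.+1.
  have k1 : (1 <= k)%N by apply: leq_trans ik.
  rewrite ler_distlC -!lee_fin fineK; last by near: k.
  apply/andP; split; last by near: k.
  apply: le_trans (ext_le' k n ik).
  rewrite lee_fin; apply: (@le_trans _ _ (pinned p k 0 n i)); first by near: k.
  by apply: pinned0_le_replaced => //; exact: alpha_distr.
(* Contrapositive of the propagation of q = 1 along the path from j to i. *)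
have path_lt1 i j : has_path p j i -> (q i < 1)%R -> (q j < 1)%R.
  move=> ji qi; rewrite lt_neqAle (andP (q01 j)).2 andbT.
  apply/negP => /eqP qj; move: qi.
  by rewrite (fixpoint1_path p_law q01 qG ji qj) ltxx.
split=> [i [part|part]|irr i]; apply: main => qi j jN.
(* Extinction implies partial extinction, so q_j is at most the partial extinction probability. *)
- rewrite -lte_fin -qE; apply: le_lt_trans (part j jN).
  exact: extinction_le_partial (Z_gw j).
- by have [_ ji] := part j jN; exact: path_lt1 ji qi.
- exact: path_lt1 (irr j i) qi.
Unshelve. all: by end_near.
Qed.
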